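(* The class $\mathbf{OBD}$ of all ordered Bratteli diagrams, with ordered morphisms (equivalence classes $[f]$ of ordered premorphisms) as arrows and with composition $[g][f]=[gf]$, is a category. Two ordered Bratteli diagrams are isomorphic in this category if and only if they are equivalent in the sense of Herman, Putnam, and Skau.
   Context: **Bratteli diagrams.** A Bratteli diagram $(V,E)$ consists of a vertex set $V=V_0\sqcup V_1\sqcup\cdots$ with each $V_n$ finite and non-empty and $V_0$ a singleton, and an edge set $E=E_1\sqcup E_2\sqcup\cdots$ with each $E_n$ finite and non-empty, together with maps $r,s:E\to V$ (range, source) such that $r(E_n)\subseteq V_n$, $s(E_n)\subseteq V_{n-1}$, $s^{-1}\{v\}\neq\varnothing$ for all $v\in V$ and $r^{-1}\{v\}\ne\varnothing$ for all $v\in V\setminus V_0$. An ordered Bratteli diagram $(V,E,\geq)$ is a Bratteli diagram with a partial order on $E$ such that $e,e'$ are comparable iff $r(e)=r(e')$ (so each $r^{-1}\{v\}$ is linearly ordered). **Edge sets.** An ordered edge set from a finite set $S$ to a finite set $T$ is a finite set $F$ with maps $s:F\to S$, $r:F\to T$ and a linear order on each $r^{-1}\{w\}$, $w\in T$. If $G$ is an ordered edge set from $T$ to $U$, then $F\circ G=\{(e,g)\in F\times G: r(e)=s(g)\}$, with source $s(e)$, range $r(g)$, and the induced (lexicographic) order: for $r(g)=r(g')$, $(e,g)<(e',g')$ iff $g<g'$, or $g=g'$ and $e<e'$. Write $F\cong F'$ if there is a (necessarily unique) bijection $F\to F'$ preserving sources, ranges and order. For $k<l$, $E_{k,l}=E_{k+1}\circ\cdots\circ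 E_l$ (paths from $V_k$ to $V_l$); $E_{k,k}$ consists of one edge from $v$ to $v$ for each $v\in V_k$. **Ordered premorphisms.** Let $B=(V,E,\geq)$, $C=(W,S,\geq)$ be ordered Bratteli diagrams. An ordered premorphism $f:B\to C$ is a triple $(F,(f_n)_{n\ge0},\geq)$ where $(f_n)$ is an unbounded sequence of integers with $0=f_0\le f_1\le f_2\le\cdots$, and $F=F_0\sqcup F_1\sqcup\cdots$ where each $F_n$ is a non-empty finite ordered edge set from $V_n$ to $W_{f_n}$ such that every $v\in V_n$ is the source and every $w\in W_{f_n}$ the range of some edge of $F_n$, $F_0$ is a singleton, and $E_{n+1}\circ F_{n+1}\cong F_n\circ S_{f_n,f_{n+1}}$ for all $n\ge0$. **Composition.** For $f=(F,(f_n),\ge):B\to C$ and $g=(G,(g_n),\ge):C\to D$, $gf=(H,(h_n),\ge)$ with $h_n=g_{f_n}$ and $H_n=F_n\circ G_{f_n}$. **Equivalence of premorphisms and morphisms.** Ordered premorphisms $f=(F,(f_n),\ge)$ and $g=(G,(g_n),\ge)$ from $B$ to $C$ are equivalent, $f\sim g$, if there are sequences of positive integers $(n_k)_{k\ge1},(m_k)_{k\ge1}$ with $n_k<m_k<n_{k+1}$ and $f_{n_k}<g_{m_k}<f_{n_{k+1}}$ such that for all $k\ge1$ $$E_{n_k,m_k}\circ G_{m_k}\cong F_{n_k}\circ S_{f_{n_k},g_{m_k}},\qquad E_{m_k,n_{k+1}}\circ F_{n_{k+1}}\cong G_{m_k}\circ S_{g_{m_k},f_{n_{k+1}}}.$$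 This is an equivalence relation; the class of $f$ is the ordered morphism $[f]:B\to C$. **Equivalence of Herman, Putnam, and Skau.** A telescoping of $(V,E,\ge)$ along $0=n_0<n_1<n_2<\cdots$ is the ordered Bratteli diagram with $k$-th vertex set $V_{n_k}$ and $k$-th edge set $E_{n_{k-1},n_k}$ with its induced order. Two ordered Bratteli diagrams are isomorphic in the sense of Herman, Putnam, and Skau if there are level-preserving bijections of vertices and of edges intertwining source and range maps and preserving the order. Equivalence in the sense of Herman, Putnam, and Skau is the equivalence relation on ordered Bratteli diagrams generated by this isomorphism and by telescoping. *)

(* Defs.v *)
From mathcomp Require Import all_boot.
From Stdlib Require Import Relation_Operators RelationClasses.
Set Implicit Arguments.
Unset Strict Implicit.
Unset Printing Implicit Defensive.

(* Linear orders on all fibres rng^-1{w} are packed into a single partial order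
   on the edges, two edges being comparable iff they have the same range. *)
Record oedgeset (S T : finType) := OEdgeSet {
  edge :> finType;
  src : edge -> S;
  rng : edge -> T;
  ele : rel edge;
  ele_refl : reflexive ele;
  ele_anti : antisymmetric ele;
  ele_trans : transitive ele;
  ele_comparable : forall e e', ele e e' || ele e' e = (rng e == rng e') }.

Definition src_onto (S T : finType) (F : oedgeset S T) : Prop :=
  forall v : S, exists e : F, src e = v.
Definition rng_onto (S T : finType) (F : oedgeset S T) : Prop :=
  forall w : T, exists e : F, rng e = w.

Definition eiso (S T : finType) (F F' : oedgeset S T) : Prop :=
  exists phi : F -> F',
    [/\ bijective phi,
        forall e, src (phi e) = src e,
        forall e, rng (phi e) = rng e
      & forall e e', ele (phi e) (phi e') = ele e e'].

Declare Scope edge_scope.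
Delimit Scope edge_scope with edge.
Notation "F ≅ G" := (eiso F G) (at level 70, no associativity) : edge_scope.
Open Scope edge_scope.

Section Composition.
Variables (S T U : finType) (F : oedgeset S T) (G : oedgeset T U).

Definition ecomp_edge : finType := {p : F * G | rng p.1 == src p.2}.
Definition ecomp_src (p : ecomp_edge) : S := src (val p).1.
Definition ecomp_rng (p : ecomp_edge) : U := rng (val p).2.
Definition ecomp_le : rel ecomp_edge := fun p q =>
  ((val p).2 == (val q).2) && ele (val p).1 (val q).1
  || ((val p).2 != (val q).2) && ele (val p).2 (val q).2.

Fact ecomp_le_refl : reflexive ecomp_le.
Proof. by move=> p; rewrite /ecomp_le eqxx ele_refl. Qed.

Fact ecomp_le_anti : antisymmetric ecomp_le.
Proof.
move=> [[e g] h] [[e' g'] h']; rewrite /ecomp_le /= => H.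
apply: val_inj => /=; move: H; rewrite [g' == g]eq_sym.
case: eqP => [->|ne] /=; first by rewrite !orbF => /ele_anti ->.
by move=> /ele_anti.
Qed.

Fact ecomp_le_trans : transitive ecomp_le.
Proof.
move=> [[e' g'] h'] [[e g] h] [[e'' g''] h'']; rewrite /ecomp_le /=.
have [->|ne1] := eqVneq g g' => /=.
  rewrite orbF; have [->|ne2] := eqVneq g' g'' => //=.
  by rewrite !orbF; apply: ele_trans.
have [<-|ne2] := eqVneq g' g'' => /=; first by rewrite (negPf ne1).
move=> le1 le2; have [eg|ne3] /= := eqVneq g g''; last exact: ele_trans le1 le2.
by case/eqP: ne1; apply: (@ele_anti _ _ G); rewrite le1 eg.
Qed.

Fact ecomp_le_comparable p q :
  ecomp_le p q || ecomp_le q p = (ecomp_rng p == ecomp_rng q).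
Proof.
case: p q => [[e g] /= h] [[e' g'] /= h']; rewrite /ecomp_le /ecomp_rng /=.
rewrite [g' == g]eq_sym; have [eg|ne] /= := eqVneq g g'.
  by rewrite !orbF ele_comparable (eqP h) (eqP h') eg !eqxx.
by rewrite ele_comparable.
Qed.

Definition ecomp : oedgeset S U :=
  @OEdgeSet S U ecomp_edge ecomp_src ecomp_rng ecomp_le
    ecomp_le_refl ecomp_le_anti ecomp_le_trans ecomp_le_comparable.

Definition ecomp_pair (e : F) (g : G) (h : rng e == src g) : ecomp :=
  exist _ (e, g) h.

Lemma ecomp_src_onto : src_onto F -> src_onto G -> src_onto ecomp.
Proof.
move=> hF hG v; have [e <-] := hF v; have [g hg] := hG (rng e).
have h : rng e == src g by rewrite hg.
by exists (ecomp_pair h).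
Qed.

Lemma ecomp_rng_onto : rng_onto F -> rng_onto G -> rng_onto ecomp.
Proof.
move=> hF hG w; have [g <-] := hG w; have [e he] := hF (src g).
have h : rng e == src g by rewrite he.
by exists (ecomp_pair h).
Qed.

End Composition.

Notation "F ∘ G" := (ecomp F G) (at level 40, left associativity) : edge_scope.

Lemma Tagged_inj (V : nat -> finType) k :
  injective (fun v : V k => Tagged (fun i => V i) v).
Proof.
move=> v w /eqP; rewrite (@eq_Tagged _ (fun i => V i) (Tagged (fun i => V i) v)).
by move/eqP.
Qed.

(* One edge from v to v for each v in V k when k = l, and no edge otherwise. *)
Section Diagonal.
Variables (V : nat -> finType) (k l : nat).

Definition diag_edge : finType :=
  {p : V k * V l | Tagged (fun i => V i) p.1 == Tagged (fun i => V i) p.2}.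
Definition diag_src (p : diag_edge) : V k := (val p).1.
Definition diag_rng (p : diag_edge) : V l := (val p).2.

Fact diag_le_refl : reflexive (fun p q : diag_edge => p == q).
Proof. by move=> p; apply: eqxx. Qed.

Fact diag_le_anti : antisymmetric (fun p q : diag_edge => p == q).
Proof. by move=> p q /andP[/eqP]. Qed.

Fact diag_le_trans : transitive (fun p q : diag_edge => p == q).
Proof. by move=> p q r /eqP -> /eqP ->. Qed.

Fact diag_le_comparable (p q : diag_edge) :
  (p == q) || (q == p) = (diag_rng p == diag_rng q).
Proof.
rewrite [q == p]eq_sym orbb; apply/eqP/eqP => [-> //|].
case: p q => [[v w] h] [[v' w'] h']; rewrite /diag_rng /= => ew.
apply: val_inj => /=; rewrite ew; congr (_, _).
move: h h'; rewrite /= ew => /eqP h /eqP h'.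
by apply: Tagged_inj; rewrite h h'.
Qed.

Definition diag : oedgeset (V k) (V l) :=
  @OEdgeSet (V k) (V l) diag_edge diag_src diag_rng (fun p q => p == q)
    diag_le_refl diag_le_anti diag_le_trans diag_le_comparable.

End Diagonal.

(* E_{k,l} for k <= l, where E n is the edge set from level n to level n + 1;
   it is empty (a junk value) for k > l. *)
Fixpoint paths (V : nat -> finType) (E : forall n, oedgeset (V n) (V n.+1))
    (k l : nat) : oedgeset (V k) (V l) :=
  match l with
  | 0 => diag V k 0
  | l'.+1 => if k <= l' then paths E k l' ∘ E l' else diag V k l'.+1
  end.

Section EdgeSetTheory.
Variables S T : finType.
Implicit Types F G H : oedgeset S T.

Lemma eiso_refl F : F ≅ F.
Proof. by exists id; split=> //; exists id. Qed.

Lemma eiso_sym F G : F ≅ G -> G ≅ F.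
Proof.
case=> phi [[psi phiK psiK] hs hr hle]; exists psi; split.
- by exists phi.
- by move=> e; rewrite -hs psiK.
- by move=> e; rewrite -hr psiK.
- by move=> e e'; rewrite -hle !psiK.
Qed.

Lemma eiso_trans F G H : F ≅ G -> G ≅ H -> F ≅ H.
Proof.
case=> phi [bphi hs hr hle] [psi [bpsi hs' hr' hle']].
exists (psi \o phi); split=> /=.
- exact: bij_comp.
- by move=> e; rewrite hs' hs.
- by move=> e; rewrite hr' hr.
- by move=> e e'; rewrite hle' hle.
Qed.

End EdgeSetTheory.

Lemma ecomp_eiso (S T U : finType) (F F' : oedgeset S T) (G G' : oedgeset T U) :
  F ≅ F' -> G ≅ G' -> F ∘ G ≅ F' ∘ G'.
Proof.
case=> phi [[phi' K1 K1'] hs hr hle] [psi [[psi' K2 K2'] hs' hr' hle']].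
have h (p : F ∘ G) : rng (phi (val p).1) == src (psi (val p).2).
  by case: p => p hp /=; rewrite hr hs'.
have h' (p : F' ∘ G') : rng (phi' (val p).1) == src (psi' (val p).2).
  by case: p => p hp /=; rewrite -hr -hs' K1' K2'.
exists (fun p => ecomp_pair (h p)); split.
- exists (fun p => ecomp_pair (h' p)).
    by case=> [[e g] ?]; apply: val_inj; rewrite /= K1 K2.
  by case=> [[e g] ?]; apply: val_inj; rewrite /= K1' K2'.
- by move=> p; apply: hs.
- by move=> p; apply: hr'.
- move=> p q; rewrite /= /ecomp_le /= hle hle'.
  by rewrite (inj_eq (can_inj K2)).
Qed.

Lemma ecompA (S T U X : finType) (F : oedgeset S T) (G : oedgeset T U)
    (H : oedgeset U X) : F ∘ G ∘ H ≅ F ∘ (G ∘ H).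
Proof.
have h1 (p : F ∘ G ∘ H) : rng (val (val p).1).2 == src (val p).2.
  by case: p => [[[[e f] h] g] h'].
have h2 (p : F ∘ G ∘ H) : rng (val (val p).1).1 == src (ecomp_pair (h1 p)).
  by case: p h1 => [[[[e f] h] g] h'].
have k1 (p : F ∘ (G ∘ H)) : rng (val p).1 == src (val (val p).2).1.
  by case: p => [[e [[f g] h]] h'].
have k2 (p : F ∘ (G ∘ H)) : rng (ecomp_pair (k1 p)) == src (val (val p).2).2.
  by case: p k1 => [[e [[f g] h]] h'].
exists (fun p => ecomp_pair (h2 p)); split=> //.
- exists (fun p => ecomp_pair (k2 p)).
    move=> [[[[e f] h] g] h']; apply: val_inj => /=; congr (_, _).
    exact: val_inj.
  move=> [[e [[f g] h]] h']; apply: val_inj => /=; congr (_, _).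
  exact: val_inj.
- move=> [[[[e f] h] g] h'] [[[[e' f'] k] g'] k'].
  rewrite /= /ecomp_le /= -val_eqE /= xpair_eqE /ecomp_le /=.
  by case: (eqVneq f f'); case: (eqVneq g g'); rewrite /= ?orbF.
Qed.

Lemma diag_edgeE (V : nat -> finType) k (p : diag V k k) : (val p).1 = (val p).2.
Proof.
by case: p => [[v w] /= /eqP h]; apply: Tagged_inj.
Qed.

Definition diag_loop (V : nat -> finType) k (v : V k) : diag V k k :=
  exist _ (v, v) (eqxx _).

Lemma ecomp1l (V : nat -> finType) k (T : finType) (F : oedgeset (V k) T) :
  diag V k k ∘ F ≅ F.
Proof.
have h (e : F) : rng (diag_loop (src e)) == src e by exact: eqxx.
have eqd (p q : diag V k k) : (val p).2 = (val q).2 -> p = q.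
  move=> e; apply: val_inj; move: (diag_edgeE p) (diag_edgeE q) e.
  by case: (val p) (val q) => [? ?] [? ?] /= -> -> ->.
exists (fun p => (val p).2); split.
- exists (fun e => ecomp_pair (h e)) => //.
  move=> [[d e] /= hp]; apply: val_inj => /=; congr (_, _).
  by apply: eqd => /=; rewrite -(eqP hp).
- move=> [[d e] /= hp]; rewrite /ecomp_src /= /diag_src diag_edgeE.
  by rewrite -(eqP hp).
- by [].
- move=> [[d e] /= hp] [[d' e'] /= hp']; rewrite /ecomp_le /=.
  have [ee|//] /= := eqVneq e e'; rewrite orbF ee ele_refl; apply/esym/eqP/eqd.
  by move: (eqP hp) (eqP hp'); rewrite ee /= /diag_rng => -> ->.
Qed.

Lemma ecomp1r (V : nat -> finType) k (S : finType) (F : oedgeset S (V k)) :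
  F ∘ diag V k k ≅ F.
Proof.
have h (e : F) : rng e == src (diag_loop (rng e)) by exact: eqxx.
have eqd (p q : diag V k k) : (val p).1 = (val q).1 -> p = q.
  move=> e; apply: val_inj; move: (diag_edgeE p) (diag_edgeE q) e.
  by case: (val p) (val q) => [? ?] [? ?] /= <- <- ->.
exists (fun p => (val p).1); split.
- exists (fun e => ecomp_pair (h e)) => //.
  move=> [[e d] /= hp]; apply: val_inj => /=; congr (_, _).
  by apply: eqd => /=; rewrite (eqP hp).
- by [].
- move=> [[e d] /= hp]; rewrite /ecomp_rng /= /diag_rng -diag_edgeE.
  by rewrite (eqP hp).
- move=> [[e d] /= hp] [[e' d'] /= hp']; rewrite /ecomp_le /=.
  have [_|ne] := eqVneq d d'; rewrite /= ?orbF //.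
  apply/negbTE/negP => hle; case/eqP: ne; apply: eqd.
  rewrite -[LHS]/(diag_src d) -[RHS]/(diag_src d') -(eqP hp) -(eqP hp').
  by apply/eqP; rewrite -ele_comparable hle.
Qed.

Lemma diag_src_onto (V : nat -> finType) k : src_onto (diag V k k).
Proof. by move=> v; exists (diag_loop v). Qed.

Lemma diag_rng_onto (V : nat -> finType) k : rng_onto (diag V k k).
Proof. by move=> v; exists (diag_loop v). Qed.

Section PathTheory.
Variables (V : nat -> finType) (E : forall n, oedgeset (V n) (V n.+1)).

Lemma pathsxx k : paths E k k = diag V k k.
Proof. by case: k => [//|k] /=; rewrite ltnn. Qed.

Lemma pathsS k l : k <= l -> paths E k l.+1 = paths E k l ∘ E l.
Proof. by move=> /= ->. Qed.

Lemma paths_cat k l m : k <= l -> l <= m ->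
  paths E k l ∘ paths E l m ≅ paths E k m.
Proof.
move=> kl; elim: m => [|m IH]; rewrite leq_eqVlt.
  by move=> /orP[/eqP <-|//]; rewrite pathsxx; apply: ecomp1r.
move=> /orP[/eqP <-|lm]; first by rewrite pathsxx; apply: ecomp1r.
rewrite !pathsS ?(leq_trans kl) //.
apply: eiso_trans (eiso_sym (ecompA _ _ _)) _.
by apply: ecomp_eiso (IH lm) (eiso_refl _).
Qed.

Lemma paths_src_onto k l : (forall n, src_onto (E n)) -> k <= l ->
  src_onto (paths E k l).
Proof.
move=> hE; elim: l => [|l IH]; rewrite leq_eqVlt.
  by move=> /orP[/eqP ->|//]; apply: diag_src_onto.
move=> /orP[/eqP ->|kl]; first by rewrite pathsxx; apply: diag_src_onto.
by rewrite pathsS //; apply: ecomp_src_onto (hE l); apply: IH.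
Qed.

Lemma paths_rng_onto k l : (forall n, rng_onto (E n)) -> k <= l ->
  rng_onto (paths E k l).
Proof.
move=> hE; elim: l => [|l IH]; rewrite leq_eqVlt.
  by move=> /orP[/eqP ->|//]; apply: diag_rng_onto.
move=> /orP[/eqP ->|kl]; first by rewrite pathsxx; apply: diag_rng_onto.
by rewrite pathsS //; apply: ecomp_rng_onto (hE l); apply: IH.
Qed.

End PathTheory.

(* Ordered Bratteli diagrams; [edges B n] is usually written E_{n+1}. *)
Record obd := OBD {
  vert : nat -> finType;
  edges : forall n, oedgeset (vert n) (vert n.+1);
  vert_root : #|vert 0| = 1;
  vert_nonempty : forall n, 0 < #|vert n|;
  edges_nonempty : forall n, 0 < #|edges n|;
  edges_src : forall n, src_onto (edges n);
  edges_rng : forall n, rng_onto (edges n) }.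

Definition epaths (B : obd) (k l : nat) : oedgeset (vert B k) (vert B l) :=
  paths (@edges B) k l.

Record premorphism (B C : obd) := Premorphism {
  lev : nat -> nat;
  lev0 : lev 0 = 0;
  lev_le : forall n, lev n <= lev n.+1;
  lev_unbounded : forall N, exists n, N <= lev n;
  conn : forall n, oedgeset (vert B n) (vert C (lev n));
  conn_nonempty : forall n, 0 < #|conn n|;
  conn_root : #|conn 0| = 1;
  conn_src : forall n, src_onto (conn n);
  conn_rng : forall n, rng_onto (conn n);
  conn_comm : forall n,
    edges B n ∘ conn n.+1 ≅ conn n ∘ epaths C (lev n) (lev n.+1) }.

Lemma lev_homo (B C : obd) (f : premorphism B C) :
  {homo lev f : m n / m <= n}.
Proof. by apply: homo_leq leqnn leq_trans _ => n; apply: lev_le. Qed.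

Lemma conn_paths (B C : obd) (f : premorphism B C) k l : k <= l ->
  epaths B k l ∘ conn f l ≅ conn f k ∘ epaths C (lev f k) (lev f l).
Proof.
have base n : epaths B n n ∘ conn f n ≅ conn f n ∘ epaths C (lev f n) (lev f n).
  rewrite /epaths !pathsxx.
  exact: eiso_trans (ecomp1l _) (eiso_sym (ecomp1r _)).
elim: l => [|l IH]; rewrite leq_eqVlt; first by move=> /orP[/eqP ->|//].
move=> /orP[/eqP ->//|kl]; rewrite {1}/epaths pathsS //.
apply: eiso_trans (ecompA _ _ _) _.
apply: eiso_trans (ecomp_eiso (eiso_refl _) (conn_comm f l)) _.
apply: eiso_trans (eiso_sym (ecompA _ _ _)) _.
apply: eiso_trans (ecomp_eiso (IH kl) (eiso_refl _)) _.
apply: eiso_trans (ecompA _ _ _) _.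
apply: ecomp_eiso (eiso_refl _) _.
by apply: paths_cat; [apply: lev_homo | apply: lev_le].
Qed.

Section PremorphismComposition.
Variables (B C D : obd) (g : premorphism C D) (f : premorphism B C).

Let h n := lev g (lev f n).
Let H n : oedgeset (vert B n) (vert D (h n)) := conn f n ∘ conn g (lev f n).

Fact prem_comp_lev0 : h 0 = 0. Proof. by rewrite /h !lev0. Qed.

Fact prem_comp_lev_le n : h n <= h n.+1.
Proof. by apply: lev_homo; apply: lev_le. Qed.

Fact prem_comp_lev_unbounded N : exists n, N <= h n.
Proof.
have [m hm] := lev_unbounded g N; have [n hn] := lev_unbounded f m.
by exists n; apply: leq_trans hm _; apply: lev_homo.
Qed.

Fact prem_comp_src n : src_onto (H n).
Proof. by apply: ecomp_src_onto; apply: conn_src. Qed.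

Fact prem_comp_rng n : rng_onto (H n).
Proof. by apply: ecomp_rng_onto; apply: conn_rng. Qed.

Fact prem_comp_nonempty n : 0 < #|H n|.
Proof.
case/card_gt0P: (vert_nonempty B n) => v _.
by case: (prem_comp_src v) => e _; apply/card_gt0P; exists e.
Qed.

Fact prem_comp_root : #|H 0| = 1.
Proof.
apply/eqP; rewrite eqn_leq prem_comp_nonempty andbT card_sig.
apply: leq_trans (max_card _) _; rewrite card_prod conn_root mul1n.
by rewrite lev0 conn_root.
Qed.

Fact prem_comp_comm n : edges B n ∘ H n.+1 ≅ H n ∘ epaths D (h n) (h n.+1).
Proof.
apply: eiso_trans (eiso_sym (ecompA _ _ _)) _.
apply: eiso_trans (ecomp_eiso (conn_comm f n) (eiso_refl _)) _.
apply: eiso_trans (ecompA _ _ _) _.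
apply: eiso_trans (eiso_sym (ecompA _ _ _)).
by apply: ecomp_eiso (eiso_refl _) _; apply: conn_paths; apply: lev_le.
Qed.

Definition prem_comp : premorphism B D :=
  @Premorphism B D h prem_comp_lev0 prem_comp_lev_le prem_comp_lev_unbounded H
    prem_comp_nonempty prem_comp_root prem_comp_src prem_comp_rng prem_comp_comm.

End PremorphismComposition.

(* The sequences (n_k), (m_k), k >= 1, are indexed from 0 here. *)
Definition prem_equiv (B C : obd) (f g : premorphism B C) : Prop :=
  exists n m : nat -> nat, forall k,
    [/\ 0 < n k /\ 0 < m k,
        n k < m k < n k.+1,
        lev f (n k) < lev g (m k) < lev f (n k.+1),
        epaths B (n k) (m k) ∘ conn g (m k)
          ≅ conn f (n k) ∘ epaths C (lev f (n k)) (lev g (m k))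
      & epaths B (m k) (n k.+1) ∘ conn f (n k.+1)
          ≅ conn g (m k) ∘ epaths C (lev g (m k)) (lev f (n k.+1))].

Definition omorphism (B C : obd) : Type :=
  {c : premorphism B C -> Prop | exists f, c = prem_equiv f}.

Definition oclass (B C : obd) (f : premorphism B C) : omorphism B C :=
  exist _ (prem_equiv f) (ex_intro _ f erefl).

Record is_category (Ob : Type) (Hom : Ob -> Ob -> Type)
    (idm : forall A, Hom A A)
    (comp : forall A B C, Hom B C -> Hom A B -> Hom A C) : Prop := IsCategory {
  cat_idl : forall A B (u : Hom A B), comp A B B (idm B) u = u;
  cat_idr : forall A B (u : Hom A B), comp A A B u (idm A) = u;
  cat_assoc : forall A B C D (u : Hom A B) (v : Hom B C) (w : Hom C D),
    comp A B D (comp B C D w v) u = comp A C D w (comp A B C v u) }.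

Definition cat_iso (Ob : Type) (Hom : Ob -> Ob -> Type)
    (idm : forall A, Hom A A)
    (comp : forall A B C, Hom B C -> Hom A B -> Hom A C) (A B : Ob) : Prop :=
  exists (u : Hom A B) (v : Hom B A),
    comp A B A v u = idm A /\ comp B A B u v = idm B.

Section Telescoping.
Variables (B : obd) (n : nat -> nat).
Hypotheses (n0 : n 0 = 0) (n_lt : forall k, n k < n k.+1).

Let V k := vert B (n k).
Let E k : oedgeset (V k) (V k.+1) := epaths B (n k) (n k.+1).

Fact tele_root : #|V 0| = 1. Proof. by rewrite /V n0 vert_root. Qed.

Fact tele_vert k : 0 < #|V k|. Proof. exact: vert_nonempty. Qed.

Fact tele_src k : src_onto (E k).
Proof. by apply: paths_src_onto (ltnW (n_lt k)); apply: edges_src. Qed.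

Fact tele_rng k : rng_onto (E k).
Proof. by apply: paths_rng_onto (ltnW (n_lt k)); apply: edges_rng. Qed.

Fact tele_edges k : 0 < #|E k|.
Proof.
case/card_gt0P: (tele_vert k) => v _.
by case: (tele_src v) => e _; apply/card_gt0P; exists e.
Qed.

Definition telescope : obd :=
  @OBD V E tele_root tele_vert tele_edges tele_src tele_rng.

End Telescoping.

(* C is a telescoping of B. *)
Definition is_telescoping (B C : obd) : Prop :=
  exists (n : nat -> nat) (n0 : n 0 = 0) (n_lt : forall k, n k < n k.+1),
    C = telescope B n0 n_lt.

Definition hps_iso (B C : obd) : Prop :=
  exists (phiV : forall n, vert B n -> vert C n)
         (phiE : forall n, edges B n -> edges C n),
    [/\ forall n, bijective (phiV n),
        forall n, bijective (phiE n),
        forall n e, src (phiE n e) = phiV n (src e),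
        forall n e, rng (phiE n e) = phiV n.+1 (rng e)
      & forall n e e', ele (phiE n e) (phiE n e') = ele e e'].

Definition hps_equiv : obd -> obd -> Prop :=
  clos_refl_sym_trans obd (fun B C => hps_iso B C \/ is_telescoping B C).

(* Main.v *)
Require Import Defs.
From Stdlib Require Import RelationClasses.
From Stdlib Require Import Setoid Morphisms Relation_Operators.
From Stdlib Require Import FunctionalExtensionality PropExtensionality.
From Stdlib Require Import ProofIrrelevance IndefiniteDescription.
From mathcomp Require Import all_boot.
Set Implicit Arguments.
Unset Strict Implicit.
Unset Printing Implicit Defensive.

(** Everything rests on a description of [prem_equiv] without sequences of
    levels.  For a premorphism f and p >= f_n, let [reach f n p] be
    F_n ∘ C_{f_n,p}, all the ways of getting from level n of B to level p of C
    through f.  Commutation of f with the paths of B and C makes these edge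
    sets compatible in n and in p.  Consequently f ~ g holds iff, for every n,
    [reach f n p] and [reach g n p] are isomorphic for some, hence for every
    larger, p ([agree], [prem_equivP]).  In this form symmetry and transitivity
    of ~ are immediate.  Since reach f n p ∘ reach g p q ≅ reach (gf) n q
    ([reach_comp]), ~ is a congruence, and the category laws come from the
    unit and associativity laws of ∘.

    A relabelling of vertices and edges gives mutually inverse premorphisms
    whose edge sets are the graphs of the vertex bijections
    ([hps_iso_cat_iso]).  A telescoping of B along (n_k) is isomorphic to B: in
    one direction level k is level n_k of B, and in the other level k of B is
    joined to level k of the telescoping by the paths of B from k to n_k >= k
    ([telescope_cat_iso]).  Hence equivalent diagrams are isomorphic.

    Conversely let f : B -> C and g : C -> B be inverse up to ~.  Along levels
    l_0 = 0 < l_1 < ... growing fast enough, form the diagram with vertex sets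
    V_{l_0}, W_{l_1}, V_{l_2}, W_{l_3}, ... and with edge sets reach f l_i
    l_{i+1} and reach g l_i l_{i+1} in turn.  Two consecutive edge sets compose
    to reach (gf) l_i l_{i+2} or reach (fg) l_i l_{i+2}, which is isomorphic to
    the paths of B or C from l_i to l_{i+2} once l_{i+2} is large.  Hence the
    telescopings of this diagram along 0, 2, 4, ... and along 0, 1, 3, 5, ...
    are, up to relabelling, telescopings of B and of C
    ([interleave_even], [interleave_odd]). *)

(** * Composition of edge sets up to isomorphism *)

#[local] Hint Resolve eiso_refl : core.

#[local] Instance eiso_equivalence (S T : finType) : Equivalence (@eiso S T).
Proof.
by split; [exact: eiso_refl | exact: eiso_sym | exact: eiso_trans].
Qed.

#[local] Instance ecomp_proper (S T U : finType) :
  Proper (@eiso S T ==> @eiso T U ==> @eiso S U) (@ecomp S T U).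
Proof. by move=> F F' hF G G' hG; apply: ecomp_eiso. Qed.

Lemma epaths_cat (B : obd) k l m : k <= l -> l <= m ->
  epaths B k l ∘ epaths B l m ≅ epaths B k m.
Proof. exact: paths_cat. Qed.

Lemma epathsxx (B : obd) k : epaths B k k = diag (vert B) k k.
Proof. exact: pathsxx. Qed.

Lemma epaths1 (B : obd) k : epaths B k k.+1 ≅ edges B k.
Proof. by rewrite /epaths pathsS // pathsxx; apply: ecomp1l. Qed.

Lemma epaths2 (B : obd) k : epaths B k k.+2 ≅ edges B k ∘ edges B k.+1.
Proof.
by rewrite -(@epaths_cat B k k.+1 k.+2) // (epaths1 B k) (epaths1 B k.+1).
Qed.

(** * Equivalence of premorphisms *)

Section Reach.
Variables B C : obd.
Implicit Types f g h : premorphism B C.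

Definition reach f n p : oedgeset (vert B n) (vert C p) :=
  conn f n ∘ epaths C (lev f n) p.

Lemma reach_paths f n p q : lev f n <= p -> p <= q ->
  reach f n p ∘ epaths C p q ≅ reach f n q.
Proof. by move=> np pq; rewrite /reach ecompA epaths_cat. Qed.

Lemma paths_reach f m n p : m <= n -> lev f n <= p ->
  epaths B m n ∘ reach f n p ≅ reach f m p.
Proof.
move=> mn np; have := lev_homo f mn => mn'.
by rewrite /reach -ecompA (conn_paths f mn) ecompA epaths_cat.
Qed.

Lemma reach_lev f n : reach f n (lev f n) ≅ conn f n.
Proof. by rewrite /reach epathsxx ecomp1r. Qed.

(** Isomorphism at a single p propagates to all larger p
    ([reach_eiso_mono]), so this says that f and g eventually coincide. *)
Definition agree f g : Prop := forall n, exists p,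
  [/\ lev f n <= p, lev g n <= p & reach f n p ≅ reach g n p].

Lemma agree_refl f : agree f f.
Proof. by move=> n; exists (lev f n); split. Qed.

Lemma agree_sym f g : agree f g -> agree g f.
Proof. by move=> fg n; have [p [fp gp /eiso_sym]] := fg n; exists p. Qed.

Lemma reach_eiso_mono f g n p q : lev f n <= p -> lev g n <= p -> p <= q ->
  reach f n p ≅ reach g n p -> reach f n q ≅ reach g n q.
Proof.
by move=> fp gp pq e; rewrite -(reach_paths fp pq) -(reach_paths gp pq) e.
Qed.

Lemma agree_trans f g h : agree f g -> agree g h -> agree f h.
Proof.
move=> fg gh n; have [p [fp gp e]] := fg n; have [q [gq hq e']] := gh n.
exists (maxn p q); have := (leq_maxl p q, leq_maxr p q) => -[pm qm].
split; [exact: leq_trans pm | exact: leq_trans qm |].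
by rewrite (reach_eiso_mono fp gp pm e) (reach_eiso_mono gq hq qm e').
Qed.

(** Since n <= n_k for k = n, the isomorphism between levels n_k and m_k can be
    preceded by the paths from n to n_k; by [paths_reach] it then compares f
    and g at level n. *)
Lemma prem_equiv_agree f g : prem_equiv f g -> agree f g.
Proof.
case=> ns [ms H] n.
have ns_ge k : k <= ns k.
  elim: k => // k IH; have [_ /andP[a b] _ _ _] := H k.
  exact: leq_ltn_trans IH (ltn_trans a b).
have [_ /andP[nm _] /andP[fg _] e _] := H n.
have nn := ns_ge n; have mm := leq_trans nn (ltnW nm).
have fnm : lev f n <= lev g (ms n).
  exact: leq_trans (lev_homo f nn) (ltnW fg).
exists (lev g (ms n)); split=> //; first exact: lev_homo.
rewrite -(paths_reach nn (ltnW fg)) -(paths_reach mm (leqnn _)).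
rewrite -(epaths_cat B nn (ltnW nm)) ecompA reach_lev.
by rewrite e.
Qed.

(** One half of one round of the zigzag in [prem_equiv].  Exchanging f and g
    gives the other half. *)
Lemma agree_step f g : agree f g -> forall n, exists m,
  [/\ n < m, lev f n < lev g m
    & epaths B n m ∘ conn g m ≅ conn f n ∘ epaths C (lev f n) (lev g m)].
Proof.
move=> fg n; have [p [fp gp e]] := fg n.
have [m hm] := lev_unbounded g p.+1.
have gm : p < lev g (maxn n.+1 m).
  by apply: leq_trans hm _; apply: lev_homo; apply: leq_maxr.
have nm := leq_maxl n.+1 m.
exists (maxn n.+1 m); split=> //; first exact: leq_ltn_trans fp gm.
rewrite -reach_lev paths_reach //; last exact: ltnW.
by apply: eiso_sym; apply: reach_eiso_mono e => //; apply: ltnW.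
Qed.

Lemma agree_prem_equiv f g : agree f g -> prem_equiv f g.
Proof.
move=> fg.
have [up upP] := functional_choice _ (agree_step fg).
have [dn dnP] := functional_choice _ (agree_step (agree_sym fg)).
pose ns k := iter k (dn \o up) 1.
exists ns, (up \o ns) => k /=.
have [a b c] := upP (ns k); have [a' b' c'] := dnP (up (ns k)).
have pos : 0 < ns k.
  elim: (k) => // j IH; rewrite /ns iterS -/(ns j) /=.
  have [u _ _] := upP (ns j); have [v _ _] := dnP (up (ns j)).
  exact: ltn_trans (ltn_trans IH u) v.
by split=> //; [split=> //; apply: ltn_trans a | apply/andP | apply/andP].
Qed.

Lemma prem_equivP f g : prem_equiv f g <-> agree f g.
Proof. by split; [apply: prem_equiv_agree | apply: agree_prem_equiv]. Qed.

Lemma prem_equiv_equivalence : Equivalence (@prem_equiv B C).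
Proof.
split=> [f|f g|f g h]; rewrite !prem_equivP.
- exact: agree_refl.
- exact: agree_sym.
- exact: agree_trans.
Qed.

End Reach.

(** Passing through the intermediate level p makes no difference: the paths of
    C from f_n to p slide across g by [paths_reach]. *)
Lemma reach_comp (B C D : obd) (g : premorphism C D) (f : premorphism B C)
    n p q : lev f n <= p -> lev g p <= q ->
  reach f n p ∘ reach g p q ≅ reach (prem_comp g f) n q.
Proof.
move=> fp gq; rewrite {1}/reach ecompA (paths_reach fp gq).
by rewrite /reach /= ecompA.
Qed.

Lemma agree_comp (B C D : obd) (g g' : premorphism C D)
    (f f' : premorphism B C) :
  agree g g' -> agree f f' -> agree (prem_comp g f) (prem_comp g' f').
Proof.
move=> gg ff n; have [p [fp fp' e]] := ff n; have [q [gq gq' e']] := gg p.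
exists q; split; [exact: leq_trans (lev_homo g fp) gq
  | exact: leq_trans (lev_homo g' fp') gq' |].
by rewrite -(reach_comp fp gq) -(reach_comp fp' gq') e e'.
Qed.

(** * The category of ordered Bratteli diagrams *)

Section Identity.
Variable B : obd.

Fact prem_id_unbounded N : exists n, N <= n.
Proof. by exists N. Qed.

Fact diag_nonempty n : 0 < #|diag (vert B) n n|.
Proof.
have /card_gt0P[v _] := vert_nonempty B n.
by apply/card_gt0P; exists (diag_loop v).
Qed.

Fact diag_root : #|diag (vert B) 0 0| = 1.
Proof.
apply/eqP; rewrite eqn_leq diag_nonempty andbT card_sig.
by apply: leq_trans (max_card _) _; rewrite card_prod vert_root.
Qed.

Fact prem_id_comm n :
  edges B n ∘ diag (vert B) n.+1 n.+1 ≅ diag (vert B) n n ∘ epaths B n n.+1.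
Proof. by rewrite ecomp1r ecomp1l epaths1. Qed.

Definition prem_id : premorphism B B :=
  @Premorphism B B id erefl leqnSn prem_id_unbounded
    (fun n => diag (vert B) n n) diag_nonempty diag_root
    (@diag_src_onto (vert B)) (@diag_rng_onto (vert B)) prem_id_comm.

Lemma reach_id n p : reach prem_id n p ≅ epaths B n p.
Proof. by rewrite /reach ecomp1l. Qed.

End Identity.

Lemma prem_comp_idl (B C : obd) (f : premorphism B C) :
  agree (prem_comp (prem_id C) f) f.
Proof. by move=> n; exists (lev f n); split=> //; rewrite /reach /= ecomp1r. Qed.

Lemma prem_comp_idr (B C : obd) (f : premorphism B C) :
  agree (prem_comp f (prem_id B)) f.
Proof. by move=> n; exists (lev f n); split=> //; rewrite /reach /= ecomp1l. Qed.

Lemma prem_comp_assoc (A B C D : obd) (f : premorphism A B)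
    (g : premorphism B C) (h : premorphism C D) :
  agree (prem_comp (prem_comp h g) f) (prem_comp h (prem_comp g f)).
Proof.
move=> n; exists (lev h (lev g (lev f n))); split=> //.
by rewrite /reach /= -(ecompA (conn f n)).
Qed.

Lemma oclass_eq (B C : obd) (f g : premorphism B C) :
  oclass f = oclass g <-> agree f g.
Proof.
have [r s t] := prem_equiv_equivalence B C.
rewrite -prem_equivP; split=> [[e]|fg]; first by rewrite e.
apply: subset_eq_compat; apply: functional_extensionality => h.
by apply: propositional_extensionality; split; apply: t => //; apply: s.
Qed.

Lemma omorphism_repr (B C : obd) (u : omorphism B C) : exists f, u = oclass f.
Proof. by case: u => c [f e]; exists f; apply: subset_eq_compat. Qed.

Definition orepr (B C : obd) (u : omorphism B C) : premorphism B C :=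
  proj1_sig (constructive_indefinite_description _ (omorphism_repr u)).

Lemma oreprK (B C : obd) (u : omorphism B C) : oclass (orepr u) = u.
Proof. by rewrite /orepr; case: constructive_indefinite_description. Qed.

Definition ocomp (B C D : obd) (v : omorphism C D) (u : omorphism B C) :
  omorphism B D := oclass (prem_comp (orepr v) (orepr u)).

Definition oid (B : obd) : omorphism B B := oclass (prem_id B).

Lemma ocompE (B C D : obd) (g : premorphism C D) (f : premorphism B C) :
  ocomp (oclass g) (oclass f) = oclass (prem_comp g f).
Proof. by apply/oclass_eq/agree_comp; apply/oclass_eq; rewrite oreprK. Qed.

Lemma obd_category : is_category oid ocomp.
Proof.
split=> [A B u|A B u|A B C D u v w].
- case: (omorphism_repr u) => f ->; rewrite ocompE.
  exact/oclass_eq/prem_comp_idl.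
- case: (omorphism_repr u) => f ->; rewrite ocompE.
  exact/oclass_eq/prem_comp_idr.
- case: (omorphism_repr u) (omorphism_repr v) (omorphism_repr w).
  move=> f -> [g ->] [h ->]; rewrite !ocompE.
  exact/oclass_eq/prem_comp_assoc.
Qed.

Lemma cat_iso_prem (B C : obd) :
  cat_iso oid ocomp B C <->
  exists (f : premorphism B C) (g : premorphism C B),
    agree (prem_comp g f) (prem_id B) /\ agree (prem_comp f g) (prem_id C).
Proof.
split=> [[u [v []]]|[f [g [gf fg]]]].
  case: (omorphism_repr u) (omorphism_repr v) => f -> [g ->].
  by rewrite !ocompE => /oclass_eq gf /oclass_eq fg; exists f, g.
by exists (oclass f), (oclass g); rewrite !ocompE; split; apply/oclass_eq.
Qed.

(** * Isomorphism in a category *)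

Section CatIso.
Variables (Ob : Type) (Hom : Ob -> Ob -> Type) (idm : forall A, Hom A A)
  (comp : forall A B C, Hom B C -> Hom A B -> Hom A C).
Hypothesis cat : is_category idm comp.

Lemma cat_iso_refl A : cat_iso idm comp A A.
Proof. by exists (idm A), (idm A); rewrite (cat_idl cat). Qed.

Lemma cat_iso_sym A B : cat_iso idm comp A B -> cat_iso idm comp B A.
Proof. by case=> u [v [vu uv]]; exists v, u. Qed.

Lemma cat_iso_trans A B C :
  cat_iso idm comp A B -> cat_iso idm comp B C -> cat_iso idm comp A C.
Proof.
case=> u [v [vu uv]] [u' [v' [vu' uv']]].
exists (comp u' u), (comp v v'); split.
  by rewrite (cat_assoc cat) -(cat_assoc cat u u' v') vu' (cat_idl cat).
by rewrite (cat_assoc cat) -(cat_assoc cat v' v u) uv (cat_idl cat).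
Qed.

End CatIso.

(** * Relabelling vertices and edges *)

(** [eiso] up to a change of vertices. *)
Definition eover (S T S' T' : finType) (a : S -> S') (b : T -> T')
    (F : oedgeset S T) (F' : oedgeset S' T') : Prop :=
  exists phi : F -> F',
    [/\ bijective phi,
        forall e, src (phi e) = a (src e),
        forall e, rng (phi e) = b (rng e)
      & forall e e', ele (phi e) (phi e') = ele e e'].

#[local] Instance eover_proper (S T S' T' : finType) (a : S -> S')
    (b : T -> T') :
  Proper (@eiso S T ==> @eiso S' T' ==> iff) (eover a b).
Proof.
have half F F' G G' : F' ≅ F -> G ≅ G' -> eover a b F G -> eover a b F' G'.
  case=> chi [bchi hs0 hr0 hle0] [psi [bpsi hs1 hr1 hle1]].
  case=> phi [bphi hs hr hle]; exists (psi \o (phi \o chi)); split=> /=.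
  - by do 2![apply: bij_comp => //].
  - by move=> e; rewrite hs1 hs hs0.
  - by move=> e; rewrite hr1 hr hr0.
  - by move=> e e'; rewrite hle1 hle hle0.
move=> F F' eF G G' eG; split; apply: half => //; exact: eiso_sym.
Qed.

Lemma hps_isoP (B C : obd) :
  hps_iso B C <->
  exists phi : forall n, vert B n -> vert C n,
    (forall n, bijective (phi n)) /\
    forall n, eover (phi n) (phi n.+1) (edges B n) (edges C n).
Proof.
split=> [[phi [phiE [b bE hs hr hle]]]|[phi [b H]]].
  by exists phi; split=> // n; exists (phiE n).
pose phiE n := constructive_indefinite_description _ (H n).
exists phi, (fun n => proj1_sig (phiE n)).
by split=> // n; case: (proj2_sig (phiE n)).
Qed.

Lemma eover_sym (S T S' T' : finType) (a : S -> S') (a' : S' -> S)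
    (b : T -> T') (b' : T' -> T) (F : oedgeset S T) (F' : oedgeset S' T') :
  cancel a a' -> cancel b b' -> eover a b F F' -> eover a' b' F' F.
Proof.
move=> aK bK [phi [[psi phiK psiK] hs hr hle]]; exists psi; split.
- by exists phi.
- by move=> e; rewrite -[in RHS](psiK e) hs aK.
- by move=> e; rewrite -[in RHS](psiK e) hr bK.
- by move=> e e'; rewrite -hle !psiK.
Qed.

Section Graph.
Variables (S T : finType) (b : S -> T) (b_inj : injective b).

Fact egraph_anti : antisymmetric (fun e e' : S => e == e').
Proof. by move=> e e' /andP[/eqP]. Qed.

Fact egraph_trans : transitive (fun e e' : S => e == e').
Proof. by move=> e e' e'' /eqP -> /eqP ->. Qed.

Fact egraph_comparable (e e' : S) : (e == e') || (e' == e) = (b e == b e').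
Proof. by rewrite [e' == e]eq_sym orbb (inj_eq b_inj). Qed.

(** The graph of an injection as an edge set: injectivity makes every fibre of
    the range map at most a point, so equality is the required order. *)
Definition egraph : oedgeset S T :=
  @OEdgeSet S T S id b (fun e e' => e == e')
    (@eqxx S) egraph_anti egraph_trans egraph_comparable.

End Graph.

(** This turns a commuting relabelling into the commutation condition of a
    premorphism.  An edge of either composite is determined by its component
    in F, respectively F'. *)
Lemma egraph_comm (S T S' T' : finType) (a : S -> S') (b : T -> T')
    (a_inj : injective a) (b_inj : injective b) F F' :
  eover a b F F' ->
  F ∘ egraph b_inj ≅ egraph a_inj ∘ F'.
Proof.
move=> [phi [[phi' K K'] hs hr hle]].
have h (p : F ∘ egraph b_inj) :
    rng (src p : egraph a_inj) == src (phi (val p).1).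
  by rewrite hs.
exists (fun p => ecomp_pair (h p)); split=> //.
- have h' (p : egraph a_inj ∘ F') :
      rng (phi' (val p).2) == src (rng (phi' (val p).2) : egraph b_inj).
    by [].
  exists (fun p => ecomp_pair (h' p)).
    by case=> [[e t] /= hp]; apply: val_inj; rewrite /= K (eqP hp).
  case=> [[s e] /= hp]; apply: val_inj; rewrite /= K'; congr (_, _).
  apply: (a_inj); rewrite /ecomp_src /=; rewrite -hs K'; exact/esym/eqP.
- by case=> [[e t] /= hp]; rewrite /ecomp_rng /= hr (eqP hp).
- case=> [[e t] /= hp] [[e' t'] /= hp']; rewrite /ecomp_le /=.
  rewrite hle (inj_eq (can_inj K)) /ecomp_src /=.
  move: hp hp' => /eqP <- /eqP <-.
  have [<-|ne] := eqVneq e e'; first by rewrite !eqxx ele_refl.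
  rewrite /=; case: eqVneq => [//|nr] /=; first by rewrite orbF.
  by apply/negbTE/negP => le; rewrite -ele_comparable le in nr.
Qed.

Lemma egraph_cancel (V : nat -> finType) k (T : finType) (a : V k -> T)
    (b : T -> V k) (a_inj : injective a) (b_inj : injective b) :
  cancel a b -> egraph a_inj ∘ egraph b_inj ≅ diag V k k.
Proof.
move=> aK.
have h (v : V k) : rng (v : egraph a_inj) == src (a v : egraph b_inj) by [].
exists (fun p => diag_loop (src p)); split=> //.
- exists (fun d => ecomp_pair (h (diag_src d))).
    case=> [[v t] /= hp]; apply: val_inj => /=; congr (_, _).
    exact: (eqP hp).
  move=> d; apply: val_inj; have := diag_edgeE d.
  by case: d => [[v w] /= ?]; rewrite /diag_src /= => {2}->.
- case=> [[v t] /= hp]; rewrite /ecomp_rng /= /diag_rng /=.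
  by rewrite -(eqP hp) /= aK.
- case=> [[v t] /= hp] [[v' t'] /= hp']; rewrite /ecomp_le /= -val_eqE /=.
  rewrite xpair_eqE andbb -(eqP hp) -(eqP hp') /= (inj_eq a_inj).
  by case: eqVneq.
Qed.

Section Relabelling.
Variables (B C : obd) (phi : forall n, vert B n -> vert C n)
  (psi : forall n, vert C n -> vert B n).
Hypotheses (phiK : forall n, cancel (@phi n) (@psi n))
  (psiK : forall n, cancel (@psi n) (@phi n))
  (phi_edges : forall n, eover (@phi n) (@phi n.+1) (edges B n) (edges C n)).

Let F n := egraph (can_inj (@phiK n)).

Fact relabel_src n : src_onto (F n).
Proof. by move=> v; exists v. Qed.

Fact relabel_rng n : rng_onto (F n).
Proof. by move=> w; exists (psi w); apply: psiK. Qed.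

Fact relabel_comm n : edges B n ∘ F n.+1 ≅ F n ∘ epaths C n n.+1.
Proof. by rewrite epaths1; apply: egraph_comm. Qed.

Definition relabel : premorphism B C :=
  @Premorphism B C id erefl leqnSn prem_id_unbounded F
    (vert_nonempty B) (vert_root B) relabel_src relabel_rng relabel_comm.

End Relabelling.

Lemma hps_iso_cat_iso (B C : obd) : hps_iso B C -> cat_iso oid ocomp B C.
Proof.
move/hps_isoP=> [phi [bphi over]].
have inv n : exists psi, cancel (phi n) psi /\ cancel psi (phi n).
  by have [psi K K'] := bphi n; exists psi.
pose psi n := constructive_indefinite_description _ (inv n).
pose phi' n := proj1_sig (psi n).
have phiK n : cancel (phi n) (phi' n) by case: (proj2_sig (psi n)).
have phi'K n : cancel (phi' n) (phi n) by case: (proj2_sig (psi n)).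
have over' n : eover (phi' n) (phi' n.+1) (edges C n) (edges B n).
  exact: eover_sym (over n).
apply/cat_iso_prem.
exists (relabel phiK phi'K over), (relabel phi'K phiK over').
split=> n; exists n; split=> //;
  by rewrite reach_id /reach /= egraph_cancel // ecomp1l.
Qed.

(** * Telescoping *)

Section TelescopingIso.
Variables (B : obd) (n : nat -> nat) (n0 : n 0 = 0)
  (n_lt : forall k, n k < n k.+1).
Let C := telescope B n0 n_lt.

Lemma tele_le k l : k <= l -> n k <= n l.
Proof. by apply: homo_leq leqnn leq_trans _ k l => k; apply: ltnW. Qed.

Lemma tele_ge k : k <= n k.
Proof. by elim: k => // k IH; apply: leq_ltn_trans IH (n_lt k). Qed.

Lemma tele_paths k l : k <= l -> epaths C k l ≅ epaths B (n k) (n l).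
Proof.
have base j : epaths C j j ≅ epaths B (n j) (n j).
  rewrite !epathsxx.
  (* Both sides are neutral for ∘, hence isomorphic to their product. *)
  pose D : oedgeset (vert C j) (vert B (n j)) := diag (vert C) j j.
  exact: (@eiso_trans (vert C j) (vert C j) _ _ _
    (eiso_sym (ecomp1r D)) (@ecomp1l (vert C) j _ (diag (vert B) (n j) (n j)))).
elim: l => [|l IH]; rewrite leq_eqVlt; first by move=> /orP[/eqP ->|].
move=> /orP[/eqP ->|kl]; first exact: base.
rewrite {1}/epaths pathsS //.
apply: eiso_trans (ecomp_eiso (IH kl) (eiso_refl _)) _.
by apply: epaths_cat; [apply: tele_le | apply: ltnW].
Qed.

Fact tele_out_unbounded N : exists k, N <= n k.
Proof. by exists N; apply: tele_ge. Qed.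

Fact tele_out_comm k :
  epaths B (n k) (n k.+1) ∘ diag (vert B) (n k.+1) (n k.+1) ≅
    diag (vert B) (n k) (n k) ∘ epaths B (n k) (n k.+1).
Proof. by rewrite ecomp1r ecomp1l. Qed.

Definition tele_out : premorphism C B :=
  @Premorphism C B n n0 (fun k => ltnW (n_lt k)) tele_out_unbounded
    (fun k => diag (vert B) (n k) (n k))
    (fun k => diag_nonempty B (n k))
    (etrans (congr1 (fun i => #|diag (vert B) i i|) n0) (diag_root B))
    (fun k => @diag_src_onto (vert B) (n k))
    (fun k => @diag_rng_onto (vert B) (n k)) tele_out_comm.

Let F k : oedgeset (vert B k) (vert C k) := epaths B k (n k).

Fact tele_in_src k : src_onto (F k).
Proof. by apply: paths_src_onto (tele_ge k); apply: edges_src. Qed.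

Fact tele_in_rng k : rng_onto (F k).
Proof. by apply: paths_rng_onto (tele_ge k); apply: edges_rng. Qed.

Fact tele_in_nonempty k : 0 < #|F k|.
Proof.
have /card_gt0P[v _] := vert_nonempty B k.
by have [e _] := tele_in_src v; apply/card_gt0P; exists e.
Qed.

Fact tele_in_root : #|F 0| = 1.
Proof. by rewrite -[LHS]/(#|epaths B 0 (n 0)|) n0 epathsxx diag_root. Qed.

Fact tele_in_comm k : edges B k ∘ F k.+1 ≅ F k ∘ epaths C k k.+1.
Proof.
apply: eiso_trans (ecomp_eiso (eiso_refl _) (eiso_sym (tele_paths (leqnSn k)))).
rewrite /F -epaths1 epaths_cat ?tele_ge //.
by apply: eiso_sym; apply: epaths_cat (tele_ge k) (ltnW (n_lt k)).
Qed.

Definition tele_in : premorphism B C :=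
  @Premorphism B C id erefl leqnSn prem_id_unbounded F tele_in_nonempty
    tele_in_root tele_in_src tele_in_rng tele_in_comm.

Lemma telescope_cat_iso : cat_iso oid ocomp B C.
Proof.
apply/cat_iso_prem; exists tele_in, tele_out.
split=> k; exists (n k); split=> //; try exact: tele_ge.
  by rewrite reach_id /reach /= ecomp1r epathsxx ecomp1r.
rewrite reach_id.
apply: eiso_trans (reach_lev (prem_comp tele_in tele_out) k) _.
apply: eiso_trans (eiso_sym (tele_paths (tele_ge k))).
exact: (@ecomp1l (vert B) (n k) _ (epaths B (n k) (n (n k)))).
Qed.

End TelescopingIso.

(** * Equivalent diagrams are isomorphic *)

Lemma hps_equiv_cat_iso (B C : obd) : hps_equiv B C -> cat_iso oid ocomp B C.
Proof.
elim=> {B C} [B C [iso | [n [n0 [n_lt ->]]]] | B | B C _ IH | B C D _ IH _ IH'].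
- exact: hps_iso_cat_iso.
- exact: telescope_cat_iso.
- exact: cat_iso_refl obd_category _.
- exact: cat_iso_sym.
- exact: cat_iso_trans obd_category _ _ _ IH IH'.
Qed.

(** * Isomorphic diagrams are equivalent *)

Lemma growing_sequence (Q : nat -> nat) : exists l : nat -> nat,
  [/\ l 0 = 0, forall i, l i < l i.+1
    & forall i j, j <= i -> Q (l j) <= l i.+1].
Proof.
pose N y := (\max_(x < y.+1) maxn x (Q x)).+1.
have NP x y : x <= y -> maxn x (Q x) < N y.
  rewrite -ltnS => xy; rewrite ltnS.
  exact: (leq_bigmax (F := fun x : 'I_y.+1 => maxn x (Q x)) (Ordinal xy)).
pose l i := iter i N 0.
have lt i : l i < l i.+1.
  by apply: leq_ltn_trans (NP _ _ (leqnn (l i))); apply: leq_maxl.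
exists l; split=> // i j ji; apply: leq_trans (leq_maxr (l j) _) (ltnW _).
apply: (NP _ (l i)); apply: homo_leq leqnn leq_trans _ _ _ ji => k.
exact: ltnW.
Qed.

Lemma card1_eq (T : finType) : #|T| = 1 -> forall x y : T, x = y.
Proof.
by move=> T1 x y; have /fintype_le1P/(_ y) -> : #|T| <= 1 by rewrite T1.
Qed.

Lemma card1_bij (S T : finType) (a : S -> T) :
  #|S| = 1 -> #|T| = 1 -> bijective a.
Proof.
move=> S1 T1; have /card_gt0P[s _] : 0 < #|S| by rewrite S1.
by exists (fun=> s) => x; apply: card1_eq.
Qed.

(** The first edge set of the interleaved diagram starts at the root of B
    instead of that of C.  As the edge set F between the two roots has one
    element, composing with F only relabels the root.  The levels z and x both
    equal 0 but are kept apart, because they arise as f_{l_0} and l_0. *)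
Lemma root_eover (S : finType) (C : obd) z x y (F : oedgeset S (vert C z))
    (a : S -> vert C x) :
  z = 0 -> x = 0 -> #|F| = 1 ->
  eover a id (F ∘ epaths C z y) (epaths C x y).
Proof.
move=> z0 x0; subst z x => F1; have /card_gt0P[e0 _] : 0 < #|F| by rewrite F1.
have V1 := card1_eq (vert_root C).
have h (p : epaths C 0 y) : rng e0 == src p by apply/eqP/V1.
exists (fun p => (val p).2); split=> //.
- exists (fun p => ecomp_pair (h p)) => //.
  by case=> [[e p] /= ?]; apply: val_inj => /=; congr (_, _); apply: card1_eq.
- case=> [[e p] ?] [[e' p'] ?]; rewrite /= /ecomp_le /=.
  rewrite (card1_eq F1 e' e) ele_refl andbT.
  by case: eqVneq => // ->; rewrite ele_refl.
Qed.

(** The interleaved diagram uses B at even and C at odd levels.  Indexing the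
    two diagrams by the parity makes its edge sets well typed as they stand,
    because the parity of i.+1 is the negation of the parity of i. *)
Definition side (B C : obd) (b : bool) : obd := if b then C else B.

Section Interleaving.
Variables (B C : obd) (f : premorphism B C) (g : premorphism C B).
Hypotheses (gf : agree (prem_comp g f) (prem_id B))
  (fg : agree (prem_comp f g) (prem_id C)).

Let X := side B C.

Definition cross (b : bool) : premorphism (X b) (X (~~ b)) :=
  if b return premorphism (X b) (X (~~ b)) then g else f.

(** Changes the side along an equality of parities, for levels such as 2k whose
    parity is known by proof and not by computation. *)
Definition recast (b c : bool) (e : b = c) n : vert (X b) n -> vert (X c) n :=
  match e with erefl => id end.

Lemma recast_bij b c (e : b = c) n : bijective (@recast b c e n).
Proof. by case: c / e; exists id. Qed.

(** Both hypotheses on f and g at once: crossing twice from side b is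
    eventually the same as following the paths of that side. *)
Lemma cross_cross b x : exists p, forall q, p <= q ->
  eover id (@recast _ _ (negbK b) q)
    (reach (prem_comp (cross (~~ b)) (cross b)) x q) (epaths (X b) x q).
Proof.
case: b; rewrite (eq_irrelevance (negbK _) erefl).
  have [p [hp hp' e]] := fg x; exists p => q pq.
  rewrite -reach_id; exact: reach_eiso_mono e.
have [p [hp hp' e]] := gf x; exists p => q pq.
rewrite -reach_id; exact: reach_eiso_mono e.
Qed.

Section Diagram.
Variable l : nat -> nat.
Hypotheses (l0 : l 0 = 0) (l_lt : forall i, l i < l i.+1)
  (l_cross : forall b i, lev (cross b) (l i) <= l i.+1)
  (l_id : forall b i, eover id (@recast _ _ (negbK b) (l i.+2))
    (reach (prem_comp (cross (~~ b)) (cross b)) (l i) (l i.+2))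
    (epaths (X b) (l i) (l i.+2))).

Let V i := vert (X (odd i)) (l i).
Let E i : oedgeset (V i) (V i.+1) := reach (cross (odd i)) (l i) (l i.+1).

Fact interleave_root : #|V 0| = 1.
Proof. by rewrite /V l0 vert_root. Qed.

Fact interleave_vert i : 0 < #|V i|.
Proof. exact: vert_nonempty. Qed.

Fact interleave_src i : src_onto (E i).
Proof.
apply: ecomp_src_onto (@conn_src _ _ _ _) _.
by apply: paths_src_onto (l_cross _ _); apply: edges_src.
Qed.

Fact interleave_rng i : rng_onto (E i).
Proof.
apply: ecomp_rng_onto (@conn_rng _ _ _ _) _.
by apply: paths_rng_onto (l_cross _ _); apply: edges_rng.
Qed.

Fact interleave_edges i : 0 < #|E i|.
Proof.
have /card_gt0P[v _] := interleave_vert i.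
by have [e _] := interleave_src v; apply/card_gt0P; exists e.
Qed.

Definition interleave : obd :=
  @OBD V E interleave_root interleave_vert interleave_edges interleave_src
    interleave_rng.

(** Two consecutive steps of the interleaved diagram cross and come back, so
    they amount to the paths of a single side. *)
Lemma interleave_paths2 b i (e : odd i = b) (e2 : odd i.+2 = b) :
  eover (@recast _ _ e (l i)) (@recast _ _ e2 (l i.+2))
    (epaths interleave i i.+2) (epaths (X b) (l i) (l i.+2)).
Proof.
case: b / e e2 => e2; rewrite (eq_irrelevance e2 (negbK (odd i))).
by rewrite epaths2 /= /E reach_comp; [apply: l_id | apply: l_cross ..].
Qed.

Lemma interleave_even : exists n0 n_lt m0 m_lt,
  hps_iso (@telescope interleave double n0 n_lt)
          (@telescope B (fun k => l k.*2) m0 m_lt).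
Proof.
have n_lt k : k.*2 < k.+1.*2 by rewrite ltn_double.
have m_lt k : l k.*2 < l k.+1.*2 by apply: ltn_trans (l_lt _).
exists erefl, n_lt, l0, m_lt; apply/hps_isoP.
exists (fun k => @recast _ false (odd_double k) (l k.*2)).
split=> k; first exact: (@recast_bij _ false (odd_double k)).
exact: (@interleave_paths2 false).
Qed.

(** Level 0 must be kept in a telescoping, so the odd levels are preceded
    by it. *)
Definition odd_level k := if k is j.+1 then j.*2.+1 else 0.

Lemma interleave_odd : exists n0 n_lt m0 m_lt,
  hps_iso (@telescope interleave odd_level n0 n_lt)
          (@telescope C (l \o odd_level) m0 m_lt).
Proof.
have n_lt k : odd_level k < odd_level k.+1.
  by case: k => //= k; rewrite ltnS ltn_double.
have m_lt k : l (odd_level k) < l (odd_level k.+1).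
  by case: k => [|k] /=; [apply: l_lt | apply: ltn_trans (l_lt _)].
exists erefl, n_lt, l0, m_lt; apply/hps_isoP.
have odd_eq k : odd k.*2.+1 = true by rewrite /= odd_double.
have /card_gt0P[w _] := vert_nonempty C (l 0).
exists (fun k => match k
    return vert interleave (odd_level k) -> vert C (l (odd_level k)) with
  | 0 => fun=> w
  | j.+1 => @recast _ true (odd_eq j) (l j.*2.+1)
  end).
split=> [[|k]|[|k]].
- by apply: card1_bij; [apply: interleave_root | rewrite /= l0 vert_root].
- exact: (@recast_bij _ true (odd_eq k)).
- rewrite /= (epaths1 interleave 0) /= (eq_irrelevance (odd_eq 0) erefl).
  apply: root_eover => //; first by rewrite l0 lev0.
  by rewrite -[LHS]/(#|conn f (l 0)|) l0 conn_root.
- exact: (@interleave_paths2 true).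
Qed.

End Diagram.

Lemma iso_hps_equiv : hps_equiv B C.
Proof.
have [P HP] :=
  functional_choice _ (fun bx : bool * nat => cross_cross bx.1 bx.2).
(* l_{i+1} must reach f_{l_i} and g_{l_i}, for the edge sets to be onto, and
   l_{i+2} must reach the bounds P at l_i, for the composites to be paths. *)
pose Q x := \max_(b : bool) maxn (lev (cross b) x) (P (b, x)).
have QP b x : maxn (lev (cross b) x) (P (b, x)) <= Q x.
  exact: (leq_bigmax (F := fun b => maxn (lev (cross b) x) (P (b, x))) b).
have [l [l0 l_lt lQ]] := growing_sequence Q.
have l_cross b i : lev (cross b) (l i) <= l i.+1.
  apply: leq_trans (lQ i i (leqnn i)).
  exact: leq_trans (leq_maxl _ _) (QP b _).
have l_id b i := HP (b, l i) (l i.+2) (leq_trans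
  (leq_trans (leq_maxr _ _) (QP b _)) (lQ i.+1 i (leqnSn i))).
have [n0 [n_lt [m0 [m_lt even]]]] := interleave_even l0 l_lt l_cross l_id.
have [n0' [n_lt' [m0' [m_lt' odd]]]] := interleave_odd l0 l_lt l_cross l_id.
have tele A n (h0 : n 0 = 0) h_lt : hps_equiv A (telescope A h0 h_lt).
  by apply: rst_step; right; exists n, h0, h_lt.
have iso A A' : hps_iso A A' -> hps_equiv A A'.
  by move=> h; apply: rst_step; left.
apply: rst_trans (tele B _ m0 m_lt) _.
apply: rst_trans (rst_sym _ _ _ _ (iso _ _ even)) _.
apply: rst_trans (rst_sym _ _ _ _ (tele _ _ n0 n_lt)) _.
apply: rst_trans (tele _ _ n0' n_lt') _.
apply: rst_trans (iso _ _ odd) _.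
exact: rst_sym (tele C _ m0' m_lt').
Qed.

End Interleaving.

Theorem proposition2p9 :
  (forall B C : obd, Equivalence (@prem_equiv B C)) /\
  exists (idm : forall B : obd, omorphism B B)
         (comp : forall B C D : obd,
            omorphism C D -> omorphism B C -> omorphism B D),
    (forall (B C D : obd) (g : premorphism C D) (f : premorphism B C),
       comp B C D (oclass g) (oclass f) = oclass (prem_comp g f)) /\
    is_category idm comp /\
    (forall B C : obd, cat_iso idm comp B C <-> hps_equiv B C).
Proof.
split; first exact: prem_equiv_equivalence.
exists oid, ocomp; split; first exact: ocompE.
split; first exact: obd_category.
move=> B C; split; last exact: hps_equiv_cat_iso.
by move/cat_iso_prem=> [f [g [gf fg]]]; apply: iso_hps_equiv gf fg.
Qed.
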